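(* Let $G = G^\top \in \mathbb{R}^{N \times N}$ be a real symmetric matrix (an undirected weighted graph on vertex set $\mathbb{V} = \{1,\dots,N\}$) with two cospectral vertices $u,v$. Let $\mathbb{M} \subseteq \mathbb{V}$, let $\gamma = (\gamma_m)_{m \in \mathbb{M}}$ be a tuple of real numbers and $p \in \{+1,-1\}$, and suppose $\mathbb{M}_\gamma^p$ is a walk multiplet of $G$ relative to $u,v$ with parity $p$. Let $H$ be the weighted cone of $G$ over $\mathbb{M}$ with weight tuple $\gamma$, with tip $c = N+1$. Then: (i) $u$ and $v$ are cospectral in $H$; (ii) the tip $c$ is a walk singlet of $H$ relative to $u,v$ with parity $p$, i.e. $[H^k]_{u,c} = p\,[H^k]_{v,c}$ for all integers $k \geq 0$; (iii) every walk multiplet of $G$ relative to $u,v$ with parity $p$ (i.e. every subset $\mathbb{Q} \subseteq \mathbb{V}$ with real weight tuple $\epsilon$ such that $\mathbb{Q}_\epsilon^p$ is a walk multiplet of $G$ relative to $u,v$) is also a walk multiplet of $H$ relative to $u,v$ with the same subset, weight tuple and parity $p$.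
   Context: A real symmetric matrix $H \in \mathbb{R}^{n \times n}$ is identified with an undirected weighted graph on vertices $1,\dots,n$, with edge weight $H_{i,j}$ between $i$ and $j$ (diagonal entries are loops). Two vertices $u,v$ are cospectral in $H$ if $[H^k]_{u,u} = [H^k]_{v,v}$ for all integers $k \geq 0$. Given a subset $\mathbb{M}$ of the vertices, a tuple $\gamma = (\gamma_m)_{m \in \mathbb{M}}$ of real numbers, and $p \in \{+1,-1\}$, $\mathbb{M}$ is called a walk multiplet $\mathbb{M}_\gamma^p$ of $H$ relative to $u,v$ with parity $p$ (even if $p=+1$, odd if $p=-1$) if $\sum_{m \in \mathbb{M}} \gamma_m [H^k]_{u,m} = p \sum_{m \in \mathbb{M}} \gamma_m [H^k]_{v,m}$ for all $k \in \{0,1,\dots,n-1\}$ (equivalently, by Cayley–Hamilton, for all integers $k \geq 0$). A walk singlet relative to $u,v$ with parity $p$ is a single vertex $c$ such that $\{c\}$ (with a nonzero weight) is a walk multiplet with parity $p$, i.e. $[H^k]_{u,c} = p[H^k]_{v,c}$ for all $k \geq 0$. The weighted cone of $G \in \mathbb{R}^{N\times N}$ over $\mathbb{M}$ with weight tuple $\gamma$ is the $(N+1)\times(N+1)$ matrix $H = \begin{bmatrix} G & e_\mathbb{M}^\gamma \\ (e_\mathbb{M}^\gamma)^\top & 0 \end{bmatrix}$, where $e_\mathbb{M}^\gamma \in \mathbb{R}^N$ has entries $\gamma_m$ for $m \in \mathbb{M}$ and $0$ otherwise; the new vertex $N+1$ is the tip. *)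

(* Defs.v *)
From mathcomp Require Import all_boot all_order all_algebra.
From mathcomp Require Import reals.

Set Implicit Arguments.
Unset Strict Implicit.
Unset Printing Implicit Defensive.

Import GRing.Theory.
Local Open Scope ring_scope.

(* Vertices are indexed from 0, i.e. they are the elements of 'I_n.  The weight
   tuple (gamma_m)_{m in M} is a function on all vertices of which only the
   values on M are ever used. *)

Definition cospectral (R : realType) (n : nat) (H : 'M[R]_n) (u v : 'I_n) : Prop :=
  forall k : nat, (H ^+ k) u u = (H ^+ k) v v.

Definition walk_multiplet (R : realType) (n : nat) (H : 'M[R]_n) (u v : 'I_n)
    (M : {set 'I_n}) (gamma : 'I_n -> R) (p : R) : Prop :=
  forall k : nat, (k < n)%N ->
    \sum_(m in M) gamma m * (H ^+ k) u m =
    p * \sum_(m in M) gamma m * (H ^+ k) v m.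

Definition walk_singlet (R : realType) (n : nat) (H : 'M[R]_n) (u v : 'I_n)
    (c : 'I_n) (p : R) : Prop :=
  exists2 g : R, g != 0 & walk_multiplet H u v [set c] (fun=> g) p.

Definition indicator_vec (R : realType) (N : nat) (M : {set 'I_N})
    (gamma : 'I_N -> R) : 'cV[R]_N :=
  \col_i (if i \in M then gamma i else 0).

Definition weighted_cone (R : realType) (N : nat) (G : 'M[R]_N)
    (M : {set 'I_N}) (gamma : 'I_N -> R) : 'M[R]_(N + 1) :=
  block_mx G (indicator_vec M gamma) (indicator_vec M gamma)^T 0.

(* A vertex, a vertex set and a weight tuple of G, viewed in a cone of G.  The
   value given to the tip in [cone_weights] is irrelevant, since the tip belongs
   to no [cone_set Q]. *)
Definition cone_vertex (N : nat) (i : 'I_N) : 'I_(N + 1) := lshift 1 i.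

Definition tip (N : nat) : 'I_(N + 1) := rshift N ord0.

Definition cone_set (N : nat) (Q : {set 'I_N}) : {set 'I_(N + 1)} :=
  [set cone_vertex q | q in Q].

Definition cone_weights (R : realType) (N : nat) (eps : 'I_N -> R)
    (i : 'I_(N + 1)) : R :=
  match split i with inl j => eps j | inr _ => 0 end.

(* Main.v *)
Require Import Defs.
From mathcomp Require Import all_boot all_order all_algebra.
From mathcomp Require Import reals.

Set Implicit Arguments.
Unset Strict Implicit.
Unset Printing Implicit Defensive.

Import GRing.Theory.
Local Open Scope ring_scope.

(* Put d := e_u - p e_v.  The multiplet condition says that d is orthogonal to
   all G^k e_M^gamma, so the row vector (d, 0) never reaches the tip:
   (d, 0) H^k = (d G^k, 0) for all k.  This gives (ii) and (iii) at once.  For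
   symmetric A, cospectrality of u and v means d A^k (e_u + p e_v)^T = 0 for all
   k, and this too is transported from G to H. *)

(* By Cayley-Hamilton, A ^+ k is a combination of the first n powers. *)
Lemma mulmx_exp_eq0 (F : fieldType) (n : nat) (A : 'M[F]_n) (d : 'rV[F]_n)
    (w : 'cV[F]_n) :
  (forall k, (k < n)%N -> d *m A ^+ k *m w = 0) ->
  forall k, d *m A ^+ k *m w = 0.
Proof.
case: n A d w => [|n] A d w Adw0 k; first by rewrite [d]thinmx0 !mul0mx.
have chi0 : char_poly A != 0 by rewrite monic_neq0 ?char_poly_monic.
(* This remainder has degree below the size of [A] and takes the same value as ['X^k] at [A], where
   [char_poly A] vanishes. *)
set q := 'X^k %% char_poly A.
have -> : A ^+ k = horner_mx A q.
  rewrite -{1}(horner_mx_X A) -rmorphXn /= [in LHS](divp_eq 'X^k (char_poly A)).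
  by rewrite rmorphD rmorphM /= Cayley_Hamilton mulr0 add0r.
have szq : (size q <= n.+1)%N.
  by rewrite -ltnS -(size_char_poly A) ltn_modp.
rewrite -(coefK q) poly_def rmorph_sum mulmx_sumr mulmx_suml big1 // => i _.
rewrite /= horner_mxZ rmorphXn /= horner_mx_X -scalemxAr -scalemxAl.
by rewrite Adw0 ?scaler0 // (leq_trans (ltn_ord i)).
Qed.

(** At [p] this is the row d, at [- p] it is e_u + p e_v: both sides of the cospectrality
    pairing. *)
Definition signed_pair (R : realType) (n : nat) (u v : 'I_n) (p : R) :
    'rV[R]_n :=
  delta_mx 0 u - p *: delta_mx 0 v.

Lemma signed_pair_mul (R : realType) (n : nat) (u v : 'I_n) (p : R)
    (A : 'M[R]_n) (w : 'cV[R]_n) :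
  (signed_pair u v p *m A *m w) 0 0 = (A *m w) u 0 - p * (A *m w) v 0.
Proof.
rewrite /signed_pair -mulmxA; move: (A *m w) => x.
by rewrite mulmxBl -scalemxAl -!rowE !mxE.
Qed.

Lemma mul_indicator_vec (R : realType) (n : nat) (A : 'M[R]_n) (u : 'I_n)
    (M : {set 'I_n}) (gamma : 'I_n -> R) :
  (A *m indicator_vec M gamma) u 0 = \sum_(m in M) gamma m * A u m.
Proof.
rewrite mxE [RHS]big_mkcond; apply: eq_bigr => i _.
by rewrite mxE; case: ifP; rewrite ?mulr0 // mulrC.
Qed.

(** Removes the bound on [k], which depends on the size of the matrix: a cone has one more vertex
    than its base, hence one more power to check. *)
Lemma walk_multipletP (R : realType) (n : nat) (A : 'M[R]_n) (u v : 'I_n)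
    (M : {set 'I_n}) (gamma : 'I_n -> R) (p : R) :
  walk_multiplet A u v M gamma p <->
  forall k, signed_pair u v p *m A ^+ k *m indicator_vec M gamma = 0.
Proof.
split=> [mult | ann k _].
  apply: mulmx_exp_eq0 => k /mult eqk; apply/matrixP => i j.
  by rewrite !ord1 signed_pair_mul !mul_indicator_vec eqk subrr mxE.
have /matrixP/(_ 0 0) := ann k.
by rewrite signed_pair_mul !mul_indicator_vec mxE => /subr0_eq.
Qed.

Lemma trmx_exp (R : comPzRingType) (n : nat) (A : 'M[R]_n) (k : nat) :
  (A ^+ k)^T = A^T ^+ k.
Proof.
elim: k => [|k IHk]; first by rewrite !expr0 trmx1.
by rewrite exprS exprSr -[in LHS]mulmxE trmx_mul IHk.
Qed.

(** The cross terms p [A^k]_{u,v} and - p [A^k]_{v,u} cancel by symmetry, and p^2 = 1 leaves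
    [A^k]_{u,u} - [A^k]_{v,v}. *)
Lemma cospectralP (R : realType) (n : nat) (A : 'M[R]_n) (u v : 'I_n) (p : R) :
  A^T = A -> p * p = 1 ->
  cospectral A u v <->
  forall k, signed_pair u v p *m A ^+ k *m (signed_pair u v (- p))^T = 0.
Proof.
move=> symA pp1.
have diag k : (signed_pair u v p *m A ^+ k *m (signed_pair u v (- p))^T) 0 0 =
    (A ^+ k) u u - (A ^+ k) v v.
  have Auv : (A ^+ k) v u = (A ^+ k) u v by rewrite -{1}symA -trmx_exp mxE.
  have col i : (A ^+ k *m (signed_pair u v (- p))^T) i 0 =
      (A ^+ k) i u + p * (A ^+ k) i v.
    rewrite /signed_pair scaleNr opprK linearD linearZ /= !trmx_delta.
    by rewrite mulmxDr -scalemxAr -!colE !mxE.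
  by rewrite signed_pair_mul !col Auv mulrDr mulrA pp1 mul1r opprD addrA
    addrK.
split=> [cosp k | ann k].
  by apply/matrixP => i j; rewrite !ord1 diag cosp subrr mxE.
by have /matrixP/(_ 0 0) := ann k; rewrite diag mxE => /subr0_eq.
Qed.

Lemma signed_pair_cone (R : realType) (N : nat) (u v : 'I_N) (p : R) :
  signed_pair (cone_vertex u) (cone_vertex v) p = row_mx (signed_pair u v p) 0.
Proof.
rewrite /signed_pair; apply/rowP => i; rewrite !mxE /cone_vertex.
case: splitP => j Ej.
  by rewrite !mxE -!(inj_eq val_inj) /= Ej.
have neq_tip (w : 'I_N) : (i == lshift 1 w) = false.
  apply/eqP => /(congr1 val) /= Ei.
  by have := ltn_ord w; rewrite -Ei Ej ltnNge leq_addr.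
by rewrite !neq_tip !andbF mulr0 subr0 mxE.
Qed.

(** Induction on [k]: one more factor of the cone turns (d G^k, 0) into (d G^(k+1), d G^k
    e_M^gamma), whose tip entry vanishes by the multiplet condition on [M]. *)
Lemma signed_pair_mul_cone_exp (R : realType) (N : nat) (G : 'M[R]_N)
    (u v : 'I_N) (M : {set 'I_N}) (gamma : 'I_N -> R) (p : R) (k : nat) :
  walk_multiplet G u v M gamma p ->
  signed_pair (cone_vertex u) (cone_vertex v) p *m weighted_cone G M gamma ^+ k
  = row_mx (signed_pair u v p *m G ^+ k) 0.
Proof.
move=> /walk_multipletP ann; rewrite signed_pair_cone.
elim: k => [|k IHk]; first by rewrite !expr0 !mulmx1.
rewrite !exprSr -!mulmxE !mulmxA IHk /weighted_cone mul_row_block.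
by rewrite ann !mul0mx !addr0.
Qed.

Lemma indicator_vec_cone (R : realType) (N : nat) (Q : {set 'I_N})
    (eps : 'I_N -> R) :
  indicator_vec (cone_set Q) (cone_weights eps) = col_mx (indicator_vec Q eps) 0.
Proof.
apply/colP => i; rewrite !mxE /cone_weights.
case: (split_ordP i) => j ->; rewrite mxE.
  by rewrite mem_imset //; apply: lshift_inj.
(* At the tip both branches are 0, by the default value in [cone_weights]. *)
by case: ifP.
Qed.

Lemma weighted_cone_sym (R : realType) (N : nat) (G : 'M[R]_N) (M : {set 'I_N})
    (gamma : 'I_N -> R) :
  G^T = G -> (weighted_cone G M gamma)^T = weighted_cone G M gamma.
Proof. by move=> symG; rewrite /weighted_cone tr_block_mx symG trmxK trmx0. Qed.

Theorem theorem1 (R : realType) (N : nat) (G : 'M[R]_N) (u v : 'I_N)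
    (M : {set 'I_N}) (gamma : 'I_N -> R) (p : R)
    (G_sym : G^T = G)
    (uv_cosp : cospectral G u v)
    (p_sign : p = 1 \/ p = -1)
    (M_mult : walk_multiplet G u v M gamma p) :
  let H := weighted_cone G M gamma in
  let u' := cone_vertex u in
  let v' := cone_vertex v in
  [/\ cospectral H u' v',
      walk_singlet H u' v' (tip N) p
        /\ (forall k : nat, (H ^+ k) u' (tip N) = p * (H ^+ k) v' (tip N))
    & forall (Q : {set 'I_N}) (eps : 'I_N -> R),
        walk_multiplet G u v Q eps p ->
        walk_multiplet H u' v' (cone_set Q) (cone_weights eps) p].
Proof.
move=> H u' v'.
have pp1 : p * p = 1 by case: p_sign => ->; rewrite ?mulrNN mulr1.
have HE k := signed_pair_mul_cone_exp k M_mult.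
have tipE k : (H ^+ k) u' (tip N) = p * (H ^+ k) v' (tip N).
  (* The tip entry of d H^k is the difference of the two sides, and [HE] says that it is 0. *)
  apply: subr0_eq; have /matrixP/(_ 0 (tip N)) := HE k.
  rewrite [tip N in RHS]/tip row_mxEr [RHS]mxE => <-.
  by rewrite /signed_pair mulmxBl -scalemxAl -!rowE !mxE.
split.
- apply/(cospectralP _ _ (weighted_cone_sym _ _ G_sym) pp1) => k.
  (* Both vectors vanish at the tip, so the pairing in [H] reduces to the one in [G]. *)
  rewrite HE signed_pair_cone tr_row_mx mul_row_col mul0mx addr0.
  by have /(cospectralP _ _ G_sym pp1) := uv_cosp.
- split=> //; exists 1; first exact: oner_neq0.
  by move=> k _; rewrite !big_set1 !mul1r tipE.
- move=> Q eps /walk_multipletP annQ; apply/walk_multipletP => k.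
  by rewrite HE indicator_vec_cone mul_row_col mul0mx addr0.
Qed.
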